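(* Let $k\ge 1$, $\ell\ge 1$, let $C=(C_{ab})$ be a symmetric real $\ell\times\ell$ matrix defining a non-degenerate inner product of signature $(u,v)$ on $\mathbb{R}^\ell$ ($u+v=\ell$), with inverse matrix $(C^{ab})$, and let $\psi=(\psi_{ij}):\mathbb{R}^\ell\to S^2(\mathbb{R}^k)$ be a smooth map into the symmetric $2$-tensors on $\mathbb{R}^k$. Let $\mathcal{M}_{C,\psi}=(\mathbb{R}^{2k+\ell},g_{C,\psi})$, where, in coordinates $(x_1,\dots,x_k,y_1,\dots,y_\ell,\bar x_1,\dots,\bar x_k)$ on $\mathbb{R}^{2k+\ell}$, $g=g_{C,\psi}$ is the pseudo-Riemannian metric of signature $(k+u,k+v)$ whose non-zero components (up to symmetry) are $$g(\partial_{x_i},\partial_{x_j})=-2\psi_{ij}(y_1,\dots,y_\ell),\quad g(\partial_{y_a},\partial_{y_b})=C_{ab},\quad g(\partial_{x_i},\partial_{\bar x_i})=1$$ for $1\le i,j\le k$ and $1\le a,b\le \ell$. Then $\mathcal{M}_{C,\psi}$ is Jacobi--Videv and its Ricci operator $\rho$ is nilpotent. Furthermore, $\mathcal{M}_{C,\psi}$ is Einstein if and only if for all $i,j$ with $1\le i,j\le k$ one has $\sum_{a,b=1}^{\ell}C^{ab}\,\partial_{y_a}\partial_{y_b}\psi_{ij}=0$ (identically on $\mathbb{R}^\ell$).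
   Context: For a pseudo-Riemannian manifold $(M,g)$ with Levi-Civita connection $\nabla$, let $\mathcal{R}(x,y)=\nabla_x\nabla_y-\nabla_y\nabla_x-\nabla_{[x,y]}$ be the curvature operator and $\mathcal{J}(x):y\mapsto\mathcal{R}(y,x)x$ the Jacobi operator. The polarized Jacobi operator is $\mathcal{J}(x_1,x_2):y\mapsto\frac12\{\mathcal{R}(y,x_1)x_2+\mathcal{R}(y,x_2)x_1\}$. The Ricci form is $\rho(x_1,x_2)=\operatorname{Tr}\{\mathcal{J}(x_1,x_2)\}$, and the Ricci operator $\rho$ is the self-adjoint endomorphism of the tangent bundle with $g(\rho x_1,x_2)=\rho(x_1,x_2)$. The manifold is Einstein if $\rho=c\operatorname{id}$ for a constant $c$. It is Jacobi--Videv if $\mathcal{J}(x)\rho=\rho\mathcal{J}(x)$ for all tangent vectors $x$ (at every point). *)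

(* Defs.v *)
From mathcomp Require Import all_boot all_order all_algebra.
From mathcomp Require Import all_classical all_reals all_analysis.
From mathcomp Require Import ring zify.

Set Implicit Arguments.
Unset Strict Implicit.
Unset Printing Implicit Defensive.

Import Order.TTheory GRing.Theory Num.Theory.
Import numFieldNormedType.Exports.

Local Open Scope ring_scope.

(* Differentiability is Frechet differentiability, as in the library, so this
   is C^infinity. *)
Definition smooth (R : realType) (V W : normedModType R) (f : V -> W) : Prop :=
  forall (vs : seq V) (p : V),
    differentiable (foldr (fun v h => 'D_v h) f vs) p.

(* The rows of P are an orthonormal basis, p vectors of square 1 followed by
   q of square -1. *)
Definition inner_product_of_signature (R : realType) (n p q : nat)
    (A : 'M[R]_n) : Prop :=
  [/\ A^T = A, A \in unitmx, (p + q)%N = n &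
      exists2 P : 'M[R]_n, P \in unitmx &
        P *m A *m P^T = diag_mx (\row_(i < n) (if (i < p)%N then 1 else -1))].

(* In the global coordinates of R^n, tangent vectors are row vectors, vector
   fields are maps 'rV_n -> 'rV_n, and a metric is the map sending p to its
   Gram matrix (g_ij(p)) in the coordinate frame. *)
Definition pseudo_riemannian (R : realType) (n p q : nat)
    (g : 'rV[R]_n -> 'M[R]_n) : Prop :=
  smooth g /\ forall x, inner_product_of_signature p q (g x).

Section Geometry.
Variables (R : realType) (n : nat) (g : 'rV[R]_n -> 'M[R]_n).
Implicit Types (p x y z : 'rV[R]_n) (X Y Z : 'rV[R]_n -> 'rV[R]_n).

Definition coord_vec (i : 'I_n) : 'rV[R]_n := delta_mx 0 i.

Definition metric p x y : R := (x *m g p *m y^T) 0 0.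

Definition dmetric p (i j l : 'I_n) : R :=
  'D_(coord_vec i) (fun q => g q j l) p.

(* christoffel p m i j is the symbol Gamma^m_ij at p. *)
Definition christoffel p (m i j : 'I_n) : R :=
  2^-1 * \sum_l invmx (g p) m l *
    (dmetric p i j l + dmetric p j i l - dmetric p l i j).

Definition nabla X Y : 'rV[R]_n -> 'rV[R]_n := fun p =>
  'D_(X p) Y p + \row_m \sum_i \sum_j christoffel p m i j * X p 0 i * Y p 0 j.

Definition lie_bracket X Y : 'rV[R]_n -> 'rV[R]_n := fun p =>
  'D_(X p) Y p - 'D_(Y p) X p.

Definition curvature_field X Y Z : 'rV[R]_n -> 'rV[R]_n := fun p =>
  nabla X (nabla Y Z) p - nabla Y (nabla X Z) p - nabla (lie_bracket X Y) Z p.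

(* The curvature is tensorial, so tangent vectors at p may be extended by any
   vector fields; we take the ones with constant coordinates. *)
Definition curvature p x y z : 'rV[R]_n :=
  curvature_field (fun=> x) (fun=> y) (fun=> z) p.

Definition jacobi p x y : 'rV[R]_n := curvature p y x x.

Definition polarized_jacobi p x1 x2 y : 'rV[R]_n :=
  2^-1 *: (curvature p y x1 x2 + curvature p y x2 x1).

Definition ricci_form p x1 x2 : R := \tr (lin1_mx (polarized_jacobi p x1 x2)).

(* Raising an index: see metric_ricci_op. *)
Definition ricci_op p x : 'rV[R]_n :=
  (\row_j ricci_form p x (coord_vec j)) *m invmx (g p).

Definition einstein : Prop := exists c : R, forall p x, ricci_op p x = c *: x.

Definition jacobi_videv : Prop :=
  forall p x y, jacobi p x (ricci_op p y) = ricci_op p (jacobi p x y).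

Definition ricci_nilpotent : Prop :=
  exists m : nat, forall p x, iter m (ricci_op p) x = 0.

Lemma nabla_torsion_free X Y p : (forall q, (g q)^T = g q) ->
  nabla X Y p - nabla Y X p = lie_bracket X Y p.
Proof.
move=> gS; rewrite /nabla opprD addrACA -[RHS]addr0; congr (_ + _).
apply/eqP; rewrite subr_eq0; apply/eqP/rowP => m; rewrite !mxE exchange_big /=.
apply: eq_bigr => j _; apply: eq_bigr => i _; rewrite mulrAC; congr (_ * _ * _).
rewrite /christoffel; congr (_ * _); apply: eq_bigr => l _; congr (_ * _).
rewrite [X in X - _]addrC; congr (_ - _); rewrite /dmetric.
by under eq_fun do rewrite -gS mxE.
Qed.

Lemma metric_ricci_op p x j : g p \in unitmx ->
  metric p (ricci_op p x) (coord_vec j) = ricci_form p x (coord_vec j).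
Proof.
move=> gU; rewrite /metric /ricci_op mulmxKV // /coord_vec trmx_delta.
by rewrite -colE !mxE.
Qed.

Lemma christoffel_lower p i j l : (g p)^T = g p -> g p \in unitmx ->
  \sum_m christoffel p m i j * g p m l =
    2^-1 * (dmetric p i j l + dmetric p j i l - dmetric p l i j).
Proof.
move=> gS gU; rewrite /christoffel.
under eq_bigr do rewrite -mulrA.
rewrite -mulr_sumr; congr (_ * _).
pose w := \col_s (dmetric p i j s + dmetric p j i s - dmetric p s i j).
have : g p *m (invmx (g p) *m w) = w by rewrite mulKVmx.
move/colP => /(_ l); rewrite !mxE => <-.
apply: eq_bigr => m _; rewrite mxE mulr_suml mulr_sumr.
apply: eq_bigr => s _; rewrite mxE mulrC; congr (_ * _).
by rewrite -{1}gS mxE.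
Qed.

Lemma derive_entry (m k : nat) (f : 'rV[R]_n -> 'M[R]_(m, k)) p v i j :
  differentiable f p -> is_derive p v (fun q => f q i j) (('D_v f p) i j).
Proof.
move=> df; have dv : derivable f p v by exact: diff_derivable.
have /derivable_mxP/(_ i j) dij := dv.
by apply: DeriveDef => //; rewrite derive_mx // mxE.
Qed.

Lemma dmetric_dir p x j l : differentiable g p ->
  ('D_x g p) j l = \sum_i x 0 i * dmetric p i j l.
Proof.
move=> dg; rewrite deriveE // {1}(row_sum_delta x) linear_sum summxE.
apply: eq_bigr => i _; rewrite linearZ mxE -deriveE //; congr (_ * _).
by have [_ <-] := derive_entry (coord_vec i) j l dg.
Qed.

Lemma nabla_metric X Y Z p :
    (forall q, (g q)^T = g q) -> g p \in unitmx ->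
    differentiable g p -> differentiable Y p -> differentiable Z p ->
  'D_(X p) (fun q => metric q (Y q) (Z q)) p =
    metric p (nabla X Y p) (Z p) + metric p (Y p) (nabla X Z p).
Proof.
move=> gS gU dg dY dZ.
have formE (A : 'M[R]_n) x y :
    (x *m A *m y^T) 0 0 = \sum_l \sum_j x 0 j * A j l * y 0 l.
  rewrite mxE; apply: eq_bigr => l _.
  by rewrite !mxE mulr_suml.
have -> : (fun q => metric q (Y q) (Z q)) =
    \sum_l \sum_j (fun q => Y q 0 j * g q j l * Z q 0 l).
  apply/funext => q; rewrite /metric formE fct_sumE; apply: eq_bigr => l _.
  by rewrite fct_sumE.
have dterm l j : is_derive p (X p) (fun q => Y q 0 j * g q j l * Z q 0 l)
   (('D_(X p) Y p) 0 j * g p j l * Z p 0 l +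
    Y p 0 j * ('D_(X p) g p) j l * Z p 0 l +
    Y p 0 j * g p j l * ('D_(X p) Z p) 0 l).
  have dYj := derive_entry (X p) 0 j dY.
  have dZl := derive_entry (X p) 0 l dZ.
  have dgjl := derive_entry (X p) j l dg.
  apply: (@is_derive_eq _ _ _ _ _ _ _ _
    (is_deriveM (is_deriveM dYj dgjl) dZl)).
  rewrite fctE /GRing.scale /=; ring.
have dterm1 l : is_derive p (X p)
    (\sum_j (fun q => Y q 0 j * g q j l * Z q 0 l)) _ :=
  is_derive_sum (fun j => dterm l j).
have [_ ->] := is_derive_sum dterm1.
under eq_bigr do rewrite !big_split.
rewrite !big_split /= -!formE.
have nablaE Y' : nabla X Y' p = 'D_(X p) Y' p +
    Y' p *m \matrix_(i, m) \sum_a X p 0 a * christoffel p m a i.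
  congr (_ + _); apply/rowP => m; rewrite !mxE exchange_big /=.
  apply: eq_bigr => i _; rewrite mxE mulr_sumr; apply: eq_bigr => a _.
  by rewrite mulrC [_ * X p 0 a]mulrC.
set G := (\matrix_(i, m) _) in nablaE.
have lower i j l : dmetric p i j l =
    \sum_m christoffel p m i j * g p m l + \sum_m christoffel p m i l * g p m j.
  rewrite !christoffel_lower //.
  have dS a b c : dmetric p a b c = dmetric p a c b.
    by rewrite /dmetric; under eq_fun do rewrite -gS mxE.
  rewrite (dS i l j) (dS l i j) (dS j i l).
  have : (2 : R) != 0 by rewrite pnatr_eq0.
  by move=> ?; field.
have -> : 'D_(X p) g p = G *m g p + g p *m G^T.
  apply/matrixP => j l; rewrite dmetric_dir // !mxE.
  under eq_bigr do rewrite lower mulrDr.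
  rewrite big_split /=; congr (_ + _).
    under [RHS]eq_bigr do rewrite mxE mulr_suml.
    rewrite exchange_big /=; apply: eq_bigr => a _.
    by rewrite mulr_sumr; apply: eq_bigr => m _; rewrite mulrA.
  under [RHS]eq_bigr do rewrite !mxE mulr_sumr.
  rewrite exchange_big /=; apply: eq_bigr => a _.
  rewrite mulr_sumr; apply: eq_bigr => m _.
  by rewrite mulrA [RHS]mulrC -{1}gS mxE.
rewrite /metric !nablaE [(_ + _)^T]linearD /= trmx_mul !(mulmxDl, mulmxDr) !mulmxA.
rewrite ![fun_of_matrix (_ + _) 0 0]mxE; ring.
Qed.

End Geometry.

(* Coordinates are ordered (x, y, xbar). *)
Definition y_coords (R : realType) (k l : nat) (p : 'rV[R]_(k + l + k)) :
    'rV[R]_l := rsubmx (lsubmx p).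

Definition g_Cpsi (R : realType) (k l : nat) (C : 'M[R]_l)
    (psi : 'rV[R]_l -> 'M[R]_k) (p : 'rV[R]_(k + l + k)) :
    'M[R]_(k + l + k) :=
  block_mx (block_mx (- 2 *: psi (y_coords p)) 0 0 C) (col_mx 1%:M 0)
           (row_mx 1%:M 0)                            0.

Section SmoothComp.
Variable R : realType.

Lemma linear_mx_differentiable (m n : nat) (W : normedModType R)
  (L : {linear 'M[R]_(m, n) -> W}) A : differentiable L A.
Proof.
have -> : (L : _ -> W) =
    \sum_(i < m) \sum_(j < n) (fun B : 'M[R]_(m, n) => B i j *: L (delta_mx i j)).
  apply/funext => B; rewrite {1}(matrix_sum_delta B) linear_sum fct_sumE.
  apply: eq_bigr => i _; rewrite linear_sum fct_sumE.
  by apply: eq_bigr => j _; rewrite linearZ.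
apply: differentiable_sum => i; apply: differentiable_sum => j.
apply: differentiableZl; exact: differentiable_coord.
Qed.

Lemma smooth_linear_comp (m n m' n' : nat) (V W : normedModType R)
    (M : {linear 'M[R]_(m, n) -> V}) (L : {linear 'M[R]_(m', n') -> W})
    (f : V -> 'M[R]_(m', n')) (c : W) :
  smooth f -> smooth (fun p => c + L (f (M p))).
Proof.
move=> sf vs.
pose h s := foldr (fun v h => 'D_v h) f s.
have comp_diff s c' p : differentiable (fun q => c' + L (h s (M q))) p.
  apply: differentiableD; first exact: differentiable_cst.
  apply: (@differentiable_comp _ _ _ _ (fun q => h s (M q)) L).
    apply: (@differentiable_comp _ _ _ _ M (h s)); last exact: sf.
    exact: linear_mx_differentiable.
  exact: linear_mx_differentiable.
suff [c' ->] : exists c', foldr (fun v h => 'D_v h)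
    (fun p => c + L (f (M p))) vs = (fun p => c' + L (h (map M vs) (M p))).
  by move=> p; exact: comp_diff.
elim: vs => [|v vs [c' IH]]; first by exists c.
exists 0; rewrite [LHS]/= IH; apply/funext => p; rewrite add0r /=.
have dM : differentiable (M : _ -> V) p by exact: linear_mx_differentiable.
have dh : differentiable (h (map M vs)) (M p) by exact: sf.
have dL : differentiable (L : _ -> W) (h (map M vs) (M p)).
  exact: linear_mx_differentiable.
rewrite deriveE; last exact: comp_diff.
have -> : (fun q => c' + L (h (map M vs) (M q))) =
  cst c' + (L \o (h (map M vs) \o M)) by [].
rewrite diffD; [|exact: differentiable_cst|]; last first.
  by apply: differentiable_comp => //; apply: differentiable_comp.
have cM : continuous (M : _ -> V).
  by move=> x; apply: differentiable_continuous; exact: linear_mx_differentiable.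
have cL : continuous (L : _ -> W).
  by move=> x; apply: differentiable_continuous; exact: linear_mx_differentiable.
rewrite diff_cst diff_comp //=; last exact: differentiable_comp.
rewrite diff_lin // (@diff_comp _ _ _ _ M (h (map M vs))) //=.
by rewrite diff_lin // deriveE // [0 v]/(0 : W) add0r.
Qed.

End SmoothComp.

Lemma g_Cpsi_pseudo_riemannian (R : realType) (k l u v : nat) (C : 'M[R]_l)
    (psi : 'rV[R]_l -> 'M[R]_k) :
    inner_product_of_signature u v C ->
    smooth psi -> (forall y, (psi y)^T = psi y) ->
  pseudo_riemannian (k + u) (k + v) (g_Cpsi C psi).
Proof.
move=> [CS CU uvl [P PU PCP]] spsi psiS; split.
  pose U : 'M[R]_(k + l + k, k) := col_mx (col_mx 1%:M 0) 0.
  have -> : g_Cpsi C psi = fun p => g_Cpsi C (fun=> 0) 0 +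
      (mulmxr U^T \o mulmx (- 2 *: U)) (psi ((rsubmx \o lsubmx) p)).
    apply/funext => p; rewrite /g_Cpsi /= -!scalemxAl.
    have -> : U *m psi (y_coords p) *m U^T =
        block_mx (block_mx (psi (y_coords p)) 0 0 0) 0 0 0.
      rewrite /U !tr_col_mx !trmx0 trmx1 !mul_col_mx !mul1mx !mul0mx.
      rewrite !mul_mx_row !mulmx1 !mulmx0 /block_mx !row_mx0.
      rewrite -[X in row_mx (col_mx _ _) X]col_mx0 -block_mxEh /block_mx.
      by rewrite row_mx0.
    by rewrite !scale_block_mx !add_block_mx !scaler0 !add0r !addr0.
  exact: smooth_linear_comp.
move=> p; set S := psi (y_coords p).
have SS : S^T = S by exact: psiS.
have gS : (g_Cpsi C psi p)^T = g_Cpsi C psi p.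
  rewrite /g_Cpsi !tr_block_mx tr_col_mx tr_row_mx !trmx0 trmx1 CS linearZ /=.
  by rewrite -/S SS.
have a_gt0 : (0 : R) < Num.sqrt 2^-1 by rewrite sqrtr_gt0 invr_gt0 ltr0n.
set a : R := Num.sqrt 2^-1 in a_gt0.
have aa2 : 2^-1 + 2^-1 = 1 :> R.
  by field.
have aa : a * a = 2^-1 by rewrite -expr2 sqr_sqrtr // invr_ge0 ler0n.
pose Q : 'M[R]_(k + l + k) :=
  block_mx (block_mx a%:M 0 0 P) (col_mx (a *: S + a%:M) 0)
           (row_mx a%:M 0)       (a *: S - a%:M).
have QgQ : Q *m g_Cpsi C psi p *m Q^T =
    diag_mx (\row_i (if (i < k + u)%N then 1 else -1)).
  have -> : \row_(i < k + l + k) (if (i < k + u)%N then 1 else -1 : R) =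
      row_mx (row_mx (const_mx 1)
                     (\row_(i < l) (if (i < u)%N then 1 else -1)))
             (const_mx (-1)).
    apply/rowP => i; rewrite mxE; case: (splitP i) => j ij.
      have -> : i = lshift k j by apply/val_inj.
      rewrite row_mxEl; case: (splitP j) => s js.
        have -> : j = lshift l s by apply/val_inj.
        by rewrite row_mxEl mxE /= ltn_addr.
      have -> : j = rshift k s by apply/val_inj.
      by rewrite row_mxEr mxE /= ltn_add2l.
    have -> : i = rshift (k + l) j by apply/val_inj.
    rewrite row_mxEr mxE /= ifF //; apply/negbTE; rewrite -leqNgt.
    by rewrite -addnA leq_add2l -uvl -addnA leq_addr.
  rewrite !diag_mx_row !diag_const_mx -PCP.
  have aaS : a *: (a *: S) + a *: (a *: S) = S.
    by rewrite -scalerDl scalerA mulrDl aa aa2 scale1r.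
  have aS2 : a *: (- 2 *: S) = - (a *: S) - a *: S.
    by rewrite scalerA mulrN scaleNr mulr_natr mulr2n scalerDl opprD.
  have Qg : Q *m g_Cpsi C psi p =
      block_mx (block_mx (a%:M - a *: S) 0 0 (P *m C)) (col_mx a%:M 0)
               (row_mx (- (a *: S) - a%:M) 0)          a%:M.
    rewrite /Q /g_Cpsi -/S mulmx_block; congr block_mx.
    - rewrite mulmx_block mul_col_row !(mul0mx, mulmx0, addr0, add0r, mulmx1).
      rewrite add_block_mx !(addr0, add0r) mul_scalar_mx; congr block_mx.
      by rewrite aS2 addrA subrK addrC.
    - rewrite mul_block_col !(mul0mx, mulmx0, addr0, add0r, mulmx1) //.
    - rewrite mul_row_block mul_mx_row !(mul0mx, mulmx0, addr0, add0r, mulmx1).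
      rewrite add_row_mx !(addr0, add0r) mul_scalar_mx; congr row_mx.
      by rewrite aS2 addrA subrK.
    - by rewrite mul_row_col !(mul0mx, mulmx0, addr0, add0r, mulmx1).
  have QT : Q^T = block_mx (block_mx a%:M 0 0 P^T) (col_mx a%:M 0)
                           (row_mx (a *: S + a%:M) 0) (a *: S - a%:M).
    rewrite /Q !tr_block_mx tr_col_mx tr_row_mx !trmx0 !tr_scalar_mx.
    by rewrite [(_ + _)^T]linearD [(_ - _)^T]linearB /= !linearZ /= !tr_scalar_mx SS.
  have aaM : a *: a%:M + a *: a%:M = 1%:M :> 'M[R]_k.
    by rewrite -scalerDl scale_scalar_mx mulrDl aa aa2.
  rewrite Qg QT mulmx_block; congr block_mx.
  - rewrite mulmx_block mul_col_row !(mul0mx, mulmx0, addr0, add0r, mulmx1).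
    rewrite add_block_mx !(addr0, add0r); congr block_mx.
    rewrite mul_mx_scalar mul_scalar_mx scalerBr scalerDr.
    by rewrite addrA subrK aaM.
  - rewrite mul_block_col mul_col_mx !(mul0mx, mulmx0, addr0, add0r, mulmx1).
    rewrite add_col_mx !addr0 mul_mx_scalar mul_scalar_mx -scalerDr.
    by rewrite addrA subrK subrr scaler0 col_mx0.
  - rewrite mul_row_block mul_mx_row !(mul0mx, mulmx0, addr0, add0r, mulmx1).
    rewrite add_row_mx !addr0 mul_mx_scalar mul_scalar_mx -scalerDr.
    by rewrite -opprD addNr scaler0 row_mx0.
  rewrite mul_row_col !(mul0mx, mulmx0, addr0, add0r, mulmx1).
  rewrite mul_mx_scalar mul_scalar_mx -scalerDr addrACA addNr add0r.
  by rewrite -opprD scalerN scalerDr aaM -[RHS]scalemx1 scaleN1r.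
have DU : diag_mx (\row_(i < k + l + k) (if (i < k + u)%N then 1 else -1 : R))
    \in unitmx.
  rewrite unitmxE det_diag unitfE; apply/prodf_neq0 => i _; rewrite mxE.
  by case: ifP; rewrite ?oppr_eq0 oner_neq0.
move: (DU); rewrite -QgQ !unitmx_mul unitmx_tr => /andP[/andP[QU gU] _].
split => //; first by rewrite -uvl; lia.
by exists Q.
Qed.

(* Main.v *)
Require Import Defs.
From mathcomp Require Import all_boot all_order all_algebra.
From mathcomp Require Import all_classical all_reals all_analysis.
From mathcomp Require Import ring.
Import Order.TTheory GRing.Theory Num.Theory.
Import numFieldNormedType.Exports.
Local Open Scope ring_scope.

(** Write a tangent vector as (a, b, c) along (x, y, xbar). The metric depends
on y only, and only its xx-block -2 psi varies, so Koszul's formula leaves few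
Christoffel symbols: the connection term of X and Y is
  (0, grad_C (psi (a_X, a_Y)), - (D_{b_X} psi) (a_Y) - (D_{b_Y} psi) (a_X)),
see [christoffel_connection]. Differentiating once more gives the curvature
([curvatureE]), from which two degeneracies can be read off: R(x,y)z never has
an x-component, and R(w,.) vanishes when w points along xbar.

In the trace of y |-> R(y,x1)x2 only the y-directions can then contribute
([trace_curvature]), and they give the bilinear form with matrix
L = sum_ab C^ab d_a d_b psi evaluated on the x-components. Raising an index
turns a covector along x into a vector along xbar, so the Ricci operator is
rho (a, b, c) = (0, 0, a L) ([ricci_opE]). It sends everything to xbar
directions and kills every vector without x-component. Hence rho^2 = 0; the
Jacobi operators kill the image of rho and take values in its kernel, so both
composites in the Jacobi-Videv condition vanish; and rho = c id forces c = 0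
(apply it to a nonzero xbar direction), which says L = 0. *)

(** * Directional derivatives and linear maps *)

(** The two difference quotients already coincide before the limit is taken. *)
Lemma derive_comp_linear (R : realType) (V W U : normedModType R)
    (L : {linear V -> W}) (f : W -> U) (p v : V) :
  'D_v (fun q => f (L q)) p = 'D_(L v) f (L p).
Proof.
rewrite /derive; set F := (X in lim (X @ _)%classic = _).
rewrite (_ : F = (fun h => h^-1 *:
  ((f \o shift (L p)) (h *: L v) - f (L p)))) //.
by apply/funext => h; rewrite /F /= linearP.
Qed.

Lemma derive_along0 (R : realType) (V W : normedModType R) (f : V -> W) p :
  'D_0 f p = 0.
Proof.
rewrite /derive (_ : (fun h => _) = cst 0) ?lim_cst //.
by apply/funext => h /=; rewrite scaler0 add0r subrr scaler0.
Qed.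

Lemma is_derive_linear_comp (R : realType) (V W : normedModType R) (m n : nat)
    (L : {linear 'M[R]_(m, n) -> W}) (f : V -> 'M[R]_(m, n)) (p v : V) :
  differentiable f p -> is_derive p v (fun q => L (f q)) (L ('D_v f p)).
Proof.
move=> df.
have dL : differentiable (L : _ -> W) (f p) by exact: linear_mx_differentiable.
have dLf : differentiable (L \o f) p by exact: differentiable_comp.
have cL : continuous (L : _ -> W).
  move=> x; apply: differentiable_continuous.
  exact: linear_mx_differentiable.
apply: DeriveDef; first exact: diff_derivable.
by rewrite deriveE //= (@diff_comp _ _ _ _ f L) //= diff_lin // deriveE.
Qed.

(** * Contracted Christoffel symbols *)

(** Koszul's formula for constant vector fields, as an equality of covectors:
lowering the index by multiplying with the Gram matrix avoids inverting it. *)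
Lemma christoffel_contract (R : realType) (n : nat) (g : 'rV[R]_n -> 'M[R]_n)
    (p x y : 'rV[R]_n) :
  (g p)^T = g p -> g p \in unitmx -> differentiable g p ->
  \row_m (\sum_i \sum_j christoffel g p m i j * x 0 i * y 0 j) *m g p =
  2^-1 *: (y *m 'D_x g p + x *m 'D_y g p -
           \row_s (x *m 'D_(coord_vec R s) g p *m y^T) 0 0).
Proof.
move=> gS gU dg; apply/rowP => s.
pose dg_ := dmetric g p.
have -> : (\row_m (\sum_i \sum_j christoffel g p m i j * x 0 i * y 0 j) *m g p)
    0 s = 2^-1 * \sum_i \sum_j
      (dg_ i j s + dg_ j i s - dg_ s i j) * (x 0 i * y 0 j).
  rewrite mxE; under eq_bigr do rewrite mxE mulr_suml.
  rewrite exchange_big mulr_sumr; apply: eq_bigr => i _ /=.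
  under eq_bigr do rewrite mulr_suml.
  rewrite exchange_big mulr_sumr; apply: eq_bigr => j _ /=.
  rewrite [RHS]mulrA /dg_ -christoffel_lower // mulr_suml.
  by apply: eq_bigr => m _; ring.
rewrite !mxE; congr (_ * _).
under eq_bigr do under eq_bigr do rewrite mulrBl mulrDl.
under eq_bigr do rewrite sumrB big_split /=.
rewrite sumrB big_split /=; congr (_ + _ - _).
- rewrite exchange_big; apply: eq_bigr => j _ /=.
  rewrite dmetric_dir // mulr_sumr; apply: eq_bigr => i _; rewrite /dg_; ring.
- apply: eq_bigr => i _ /=.
  rewrite dmetric_dir // mulr_sumr; apply: eq_bigr => j _; rewrite /dg_; ring.
rewrite exchange_big /=; apply: eq_bigr => j _; rewrite !mxE mulr_suml.
apply: eq_bigr => i _.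
have [_] := derive_entry (coord_vec R s) i j dg.
by rewrite /dg_ /dmetric => ->; ring.
Qed.

(** * The Levi-Civita connection of the metric *)

Section CpsiMetric.
Variables (R : realType) (k l u v : nat) (C : 'M[R]_l).
Variable psi : 'rV[R]_l -> 'M[R]_k.
Hypothesis hC : inner_product_of_signature u v C.
Hypothesis hpsi : smooth psi.
Hypothesis hpsi_sym : forall y : 'rV[R]_l, (psi y)^T = psi y.

Local Notation T := 'rV[R]_(k + l + k).
Local Notation g := (g_Cpsi C psi).
Implicit Types (p x y z w : T).

Definition x_coords (p : T) : 'rV[R]_k := lsubmx (lsubmx p).

Definition from_y (b : 'rV[R]_l) : T := row_mx (row_mx 0 b) 0.
Definition from_xbar (c : 'rV[R]_k) : T := row_mx 0 c.

(** The C-gradient at [y_coords p] of the function psi(x, y), for fixed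
x-components of the two vectors: entry a of the differential is a 1 x 1 matrix
multiplying row a of C^-1. *)
Definition grad_psi p (x y : T) : 'rV[R]_l :=
  \sum_a x_coords x *m 'D_(delta_mx 0 a) psi (y_coords p) *m (x_coords y)^T
    *m row a (invmx C).

(** The covector (D_x psi)(y, .) on the x-directions. *)
Definition dpsi_covector p x y : 'rV[R]_k :=
  x_coords y *m 'D_(y_coords x) psi (y_coords p).

(** The closed form of Gamma^m_ij x^i y^j, see [christoffel_connection]. *)
Definition connection p x y : T :=
  from_y (grad_psi p x y)
  - from_xbar (dpsi_covector p x y + dpsi_covector p y x).

Let gP : pseudo_riemannian (k + u) (k + v) g.
Proof. exact: g_Cpsi_pseudo_riemannian. Qed.

Lemma g_sym p : (g p)^T = g p.
Proof. by case: gP => _ /(_ p)[]. Qed.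

Lemma g_unit p : g p \in unitmx.
Proof. by case: gP => _ /(_ p)[]. Qed.

Lemma g_differentiable p : differentiable g p.
Proof. by case: gP => /(_ [::] p). Qed.

Lemma C_unit : C \in unitmx.
Proof. by case: hC. Qed.

(** The coordinate frame along x, as columns: multiplying a row vector by it
extracts the x-components, and multiplying by its transpose embeds a covector
on the x-directions. *)
Definition x_frame : 'M[R]_(k + l + k, k) := col_mx (col_mx 1%:M 0) 0.

Lemma mul_x_frame (x : T) : x *m x_frame = x_coords x.
Proof.
rewrite -[x in LHS]hsubmxK -[lsubmx x]hsubmxK !mul_row_col.
by rewrite mulmx1 !mulmx0 !addr0.
Qed.

Lemma mul_x_frameT (c : 'rV[R]_k) : c *m x_frame^T = row_mx (row_mx c 0) 0.
Proof. by rewrite !tr_col_mx !trmx0 trmx1 !mul_mx_row mulmx1 !mulmx0. Qed.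

(** Isolates the varying part of the metric in a form that is linear in psi, so
that it can be differentiated through [is_derive_psi]. *)
Lemma g_decomposition p :
  g p = g_Cpsi C (fun=> 0) (0 : T)
        + x_frame *m (- 2 *: psi (y_coords p)) *m x_frame^T.
Proof.
set A := - 2 *: _; rewrite -/A.
have -> : x_frame *m A *m x_frame^T = block_mx (block_mx A 0 0 0) 0 0 0.
  rewrite /x_frame !tr_col_mx !trmx0 trmx1 !mul_col_mx !mul1mx !mul0mx.
  rewrite !mul_mx_row !mulmx1 !mulmx0 /block_mx !row_mx0.
  by rewrite -[X in row_mx (col_mx _ _) X]col_mx0 -block_mxEh /block_mx row_mx0.
by rewrite /g_Cpsi -/A !add_block_mx !scaler0 !add0r !addr0.
Qed.

(** The iterated derivatives of psi are written with the same [foldr] as in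
[smooth], so that one statement serves for the metric ([vs] empty) and for the
connection ([vs] of length one). *)
Lemma is_derive_psi p w (m n : nat) (A : 'M[R]_(m, k)) (B : 'M[R]_(k, n)) vs :
  is_derive p w
    (fun q => A *m foldr (fun v h => 'D_v h) psi vs (y_coords q) *m B)
    (A *m foldr (fun v h => 'D_v h) psi (y_coords w :: vs) (y_coords p) *m B).
Proof.
set h := foldr _ psi vs.
have dh (q0 : T) : differentiable (fun q : T => h (y_coords q)) q0.
  apply: (@differentiable_comp _ _ _ _ (rsubmx \o lsubmx) h); last exact: hpsi.
  exact: linear_mx_differentiable.
have := @is_derive_linear_comp R T _ _ _ (mulmxr B \o mulmx A)
  (fun q => h (y_coords q)) p w (dh p).
by rewrite (@derive_comp_linear R _ _ _ (rsubmx \o lsubmx) h).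
Qed.

Lemma derive_g p w : 'D_w g p =
  x_frame *m (- 2 *: 'D_(y_coords w) psi (y_coords p)) *m x_frame^T.
Proof.
rewrite (_ : g = cst (g_Cpsi C (fun=> 0) (0 : T)) +
  (fun q => (- 2 *: x_frame) *m psi (y_coords q) *m x_frame^T)); last first.
  apply/funext => q; rewrite g_decomposition; congr (_ + _).
  by rewrite -scalemxAr -!scalemxAl.
have dpsi := is_derive_psi p w _ _ (- 2 *: x_frame) x_frame^T [::].
have dcst : is_derive p w (cst (g_Cpsi C (fun=> 0) (0 : T))) 0 :=
  is_derive_cst _ _ _.
have [_ ->] := is_deriveD dcst dpsi.
by rewrite add0r -scalemxAr -!scalemxAl.
Qed.

Lemma x_coordsB : {morph x_coords : x y / x - y}.
Proof. by move=> x y; rewrite /x_coords !linearB. Qed.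

Lemma y_coordsB : {morph @y_coords R k l : x y / x - y}.
Proof. by move=> x y; rewrite /y_coords !linearB. Qed.

Lemma x_coordsD : {morph x_coords : x y / x + y}.
Proof. by move=> x y; rewrite /x_coords !linearD. Qed.

Lemma y_coordsD : {morph @y_coords R k l : x y / x + y}.
Proof. by move=> x y; rewrite /y_coords !linearD. Qed.

Lemma x_from_y b : x_coords (from_y b) = 0.
Proof. by rewrite /x_coords /from_y !row_mxKl. Qed.

Lemma y_from_y b : y_coords (from_y b) = b.
Proof. by rewrite /y_coords /from_y row_mxKl row_mxKr. Qed.

Lemma x_from_xbar c : x_coords (from_xbar c) = 0.
Proof. by rewrite /x_coords /from_xbar row_mxKl linear0. Qed.

Lemma y_from_xbar c : y_coords (from_xbar c) = 0.
Proof. by rewrite /y_coords /from_xbar row_mxKl linear0. Qed.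

Lemma from_y_g p b : from_y b *m g p = row_mx (row_mx 0 (b *m C)) 0.
Proof.
rewrite /from_y /g_Cpsi mul_row_block mul_row_block mul_row_col.
by rewrite !(mul0mx, mulmx0, addr0, add0r).
Qed.

Lemma from_xbar_g p c : from_xbar c *m g p = c *m x_frame^T.
Proof.
rewrite /from_xbar /g_Cpsi mul_row_block mul_mx_row mul_x_frameT.
by rewrite !(mul0mx, mulmx0, addr0, add0r, mulmx1).
Qed.

Lemma grad_psi_C p x y : grad_psi p x y *m C =
  \row_a (x_coords x *m 'D_(delta_mx 0 a) psi (y_coords p)
            *m (x_coords y)^T) 0 0.
Proof.
rewrite /grad_psi mulmx_suml; apply/rowP => b; rewrite summxE (bigD1 b) //=.
rewrite big1 ?addr0 => [|a nab]; rewrite -mulmxA -row_mul mulVmx ?C_unit //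
  row1 [LHS]mxE big_ord1 !mxE ?eqxx.
  by rewrite mulr1.
by rewrite eq_sym (negbTE nab) mulr0.
Qed.

Lemma y_coord_vec a :
  y_coords (coord_vec R (lshift k (rshift k a))) = delta_mx 0 a :> 'rV[R]_l.
Proof. by rewrite /coord_vec delta_mx_lshift delta_mx_rshift y_from_y. Qed.

Lemma x_coord_vec_y a : x_coords (coord_vec R (lshift k (rshift k a))) = 0.
Proof. by rewrite /coord_vec delta_mx_lshift delta_mx_rshift x_from_y. Qed.

Lemma y_coord_vec_xbar i : y_coords (coord_vec R (rshift (k + l) i)) = 0.
Proof. by rewrite /coord_vec delta_mx_rshift y_from_xbar. Qed.

Lemma y_coord_vec_x i :
  y_coords (coord_vec R (lshift k (lshift l i))) = 0 :> 'rV[R]_l.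
Proof. by rewrite /coord_vec !delta_mx_lshift /y_coords row_mxKl row_mxKr. Qed.

(** Only the coordinate directions along y see the metric vary, so the last
term of Koszul's formula is a covector on the y-directions, the one that
[grad_psi] turns into a vector. *)
Lemma row_y_derivs p x y :
  \row_s (x_coords x *m 'D_(y_coords (coord_vec R s)) psi (y_coords p)
             *m (x_coords y)^T) 0 0 =
  row_mx (row_mx 0 (grad_psi p x y *m C)) 0 :> T.
Proof.
rewrite grad_psi_C; apply/rowP => s; rewrite mxE.
case: (split_ordP s) => [t ->|i ->].
  rewrite row_mxEl; case: (split_ordP t) => [i ->|a ->].
    by rewrite row_mxEl y_coord_vec_x derive_along0 mulmx0 mul0mx !mxE.
  by rewrite row_mxEr y_coord_vec [RHS]mxE.
by rewrite row_mxEr y_coord_vec_xbar derive_along0 mulmx0 mul0mx !mxE.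
Qed.

(** Both sides have the same covector under [g p]: the left one by Koszul's
formula, the right one because [g p] turns vectors along xbar into covectors on
the x-directions and acts as C on those along y. *)
Lemma christoffel_connection p x y :
  \row_m (\sum_i \sum_j christoffel g p m i j * x 0 i * y 0 j) =
  connection p x y.
Proof.
apply: (can_inj (mulmxK (g_unit p))).
rewrite christoffel_contract ?g_sym ?g_unit //; last exact: g_differentiable.
rewrite /connection mulmxBl from_y_g from_xbar_g -row_y_derivs.
have dgE z w : z *m 'D_w g p =
    - 2 *: (x_coords z *m 'D_(y_coords w) psi (y_coords p) *m x_frame^T).
  by rewrite derive_g !mulmxA mul_x_frame -scalemxAr -scalemxAl.
rewrite [X in X + _ - _](dgE y x) [X in _ + X - _](dgE x y).
rewrite /dpsi_covector mulmxDl.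
set M := \row_s _; have -> : M = - 2 *: \row_s (x_coords x *m
    'D_(y_coords (coord_vec R s)) psi (y_coords p) *m (x_coords y)^T) 0 0.
  apply/rowP => s; rewrite mxE (dgE x) -scalemxAl -mulmxA -trmx_mul mul_x_frame.
  by rewrite [LHS]mxE [RHS]mxE; congr (_ * _); rewrite [RHS]mxE.
rewrite -scalerDr -scalerBr scalerA mulrN mulVf ?pnatr_eq0 // scaleN1r.
by rewrite opprB.
Qed.

(** * Curvature *)

Local Notation hess p a b := ('D_a ('D_b psi) (y_coords p)).

(** The derivative of [grad_psi p x y] in the direction [w]. *)
Definition grad_hess p w x y : 'rV[R]_l :=
  \sum_a x_coords x *m hess p (y_coords w) (delta_mx 0 a)
    *m (x_coords y)^T *m row a (invmx C).

Lemma derive_connection p w x y : 'D_w (fun q => connection q x y) p =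
  from_y (grad_hess p w x y)
  - from_xbar (x_coords y *m hess p (y_coords w) (y_coords x)
               + x_coords x *m hess p (y_coords w) (y_coords y)).
Proof.
(* Embeddings as right multiplications, to reach the shape A *m _ *m B. *)
pose Fy : 'M[R]_(l, k + l + k) := row_mx (row_mx 0 1%:M) 0.
pose Fz : 'M[R]_(k, k + l + k) := row_mx 0 1%:M.
have FyE (b : 'rV_l) : from_y b = b *m Fy.
  by rewrite /Fy !mul_mx_row mulmx1 !mulmx0.
have FzE (c : 'rV_k) : from_xbar c = c *m Fz.
  by rewrite /Fz !mul_mx_row mulmx1 !mulmx0.
rewrite (_ : (fun q => _) =
  \sum_a (fun q : T => x_coords x *m 'D_(delta_mx 0 a) psi (y_coords q)
             *m ((x_coords y)^T *m row a (invmx C) *m Fy))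
  - ((fun q : T => x_coords y *m 'D_(y_coords x) psi (y_coords q) *m Fz)
     + (fun q : T => x_coords x *m 'D_(y_coords y) psi (y_coords q) *m Fz)));
  last first.
  apply/funext => q; rewrite /connection FyE FzE mulmxDl mulmx_suml.
  rewrite [in RHS]fctE fct_sumE; congr (_ - _).
  by apply: eq_bigr => a _; rewrite !mulmxA.
have dy a := is_derive_psi p w _ _ (x_coords x)
  ((x_coords y)^T *m row a (invmx C) *m Fy) [:: delta_mx 0 a].
have dyx := is_derive_psi p w _ _ (x_coords y) Fz [:: y_coords x].
have dxy := is_derive_psi p w _ _ (x_coords x) Fz [:: y_coords y].
have [_ ->] := is_deriveB (is_derive_sum dy) (is_deriveD dyx dxy).
rewrite FyE FzE mulmxDl mulmx_suml; congr (_ - _).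
by apply: eq_bigr => a _; rewrite !mulmxA.
Qed.

Lemma nabla_const p x Y :
  nabla g (fun=> x) Y p = 'D_x Y p + connection p x (Y p).
Proof. by rewrite -christoffel_connection. Qed.

Lemma grad_psi_x0 p x y : x_coords x = 0 -> grad_psi p x y = 0.
Proof. by move=> x0; apply: big1 => a _; rewrite x0 !mul0mx. Qed.

Lemma connection0 p x y :
  x_coords x = 0 -> y_coords x = 0 -> connection p x y = 0.
Proof.
move=> x0 y0; rewrite /connection grad_psi_x0 // /dpsi_covector x0 y0 mul0mx.
by rewrite derive_along0 mulmx0 addr0 /from_y /from_xbar !row_mx0 subr0.
Qed.

(** The inner vector has no x-component, and its xbar-component is invisible to
the connection: only the pairing of its y-component with x survives. *)
Lemma connection_connection p x y z : connection p x (connection p y z) =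
  - from_xbar (x_coords x *m 'D_(grad_psi p y z) psi (y_coords p)).
Proof.
have xG : x_coords (connection p y z) = 0.
  by rewrite /connection x_coordsB x_from_y x_from_xbar subr0.
have yG : y_coords (connection p y z) = grad_psi p y z.
  by rewrite /connection y_coordsB y_from_y y_from_xbar subr0.
rewrite {1}/connection /dpsi_covector xG yG mul0mx add0r.
rewrite (_ : grad_psi p x _ = 0) ?/from_y ?row_mx0 ?sub0r //.
by apply: big1 => a _; rewrite xG trmx0 mulmx0 mul0mx.
Qed.

(** The terms with [hess] come from differentiating the connection, those with
[grad_psi] from composing it with itself. The commutator of two partial
derivatives of psi is kept as the expansion produces it. *)
Lemma curvatureE p x y z : curvature g p x y z =
  from_y (grad_hess p x y z - grad_hess p y x z)
  + from_xbar (x_coords x *m hess p (y_coords y) (y_coords z)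
               - x_coords y *m hess p (y_coords x) (y_coords z)
               + x_coords z *m (hess p (y_coords y) (y_coords x)
                                - hess p (y_coords x) (y_coords y))
               + x_coords y *m 'D_(grad_psi p x z) psi (y_coords p)
               - x_coords x *m 'D_(grad_psi p y z) psi (y_coords p)).
Proof.
have cst_field w : nabla g (fun=> w) (fun=> z) = fun q => connection q w z.
  by apply/funext => q; rewrite nabla_const derive_cst add0r.
have bracket0 : lie_bracket (fun=> x) (fun=> y) = fun=> 0.
  by apply/funext => q; rewrite /lie_bracket !derive_cst subrr.
rewrite /curvature /curvature_field bracket0 !cst_field !nabla_const.
rewrite !derive_connection !connection_connection.
(* The covariant derivative along the zero bracket. *)
have -> : connection p 0 z = 0.
  by apply: connection0; rewrite /x_coords /y_coords !linear0.
rewrite subr0.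
have lin (A1 A2 : 'rV_l) (B1 B1' B2 B2' C1 C2 : 'rV_k) :
    from_y A1 - from_xbar (B1 + B1') + - from_xbar C1
      - (from_y A2 - from_xbar (B2 + B2') + - from_xbar C2) =
    from_y (A1 - A2) + from_xbar (B2' - B1' + (B2 - B1) + C2 - C1).
  apply/rowP => i; rewrite !mxE.
  case: fintype.split => j; rewrite !mxE; last by ring.
  by case: fintype.split => s; rewrite ?mxE; ring.
by rewrite lin mulmxBr.
Qed.

Lemma x_curvature p x y z : x_coords (curvature g p x y z) = 0.
Proof. by rewrite curvatureE x_coordsD x_from_y x_from_xbar addr0. Qed.

Lemma y_curvature p x y z :
  y_coords (curvature g p x y z) = grad_hess p x y z - grad_hess p y x z.
Proof. by rewrite curvatureE y_coordsD y_from_y y_from_xbar addr0. Qed.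

Lemma grad_hess_x0 p w x y : x_coords x = 0 -> grad_hess p w x y = 0.
Proof. by move=> x0; apply: big1 => a _; rewrite x0 !mul0mx. Qed.

(** Every term of [curvatureE] contains the first argument through its x- or its
y-component, and these vanish along xbar. *)
Lemma curvature_xbar p c y z : curvature g p (from_xbar c) y z = 0.
Proof.
rewrite curvatureE x_from_xbar y_from_xbar !mul0mx.
rewrite [grad_hess p y _ z]grad_hess_x0 ?x_from_xbar // subr0 subr0.
have -> : grad_hess p (from_xbar c) y z = 0.
  apply: big1 => a _.
  by rewrite y_from_xbar derive_along0 mulmx0 !mul0mx.
have -> : grad_psi p (from_xbar c) z = 0.
  by apply: big1 => a _; rewrite x_from_xbar !mul0mx.
rewrite [X in _ - x_coords y *m X]derive_along0.
rewrite [X in x_coords z *m (_ - X)]derive_along0.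
rewrite [X in x_coords z *m (X - _)](_ : _ = 0); last first.
  rewrite (_ : 'D_0 psi = cst 0) ?derive_cst //.
  by apply/funext => q; exact: derive_along0.
rewrite [X in _ + x_coords y *m X]derive_along0.
rewrite !(mulmx0, subr0, addr0).
by rewrite /from_y /from_xbar !row_mx0 addr0.
Qed.

(** * The Ricci operator *)

Definition laplacian_psi (y : 'rV[R]_l) : 'M[R]_k :=
  \sum_a \sum_b invmx C a b *: 'D_(delta_mx 0 a) ('D_(delta_mx 0 b) psi) y.

Lemma laplacian_psi_entry (y : 'rV[R]_l) i j : laplacian_psi y i j =
  \sum_a \sum_b invmx C a b *
    'D_(delta_mx 0 a) ('D_(delta_mx 0 b) (fun r : 'rV[R]_l => psi r i j)) y.
Proof.
rewrite summxE; apply: eq_bigr => a _; rewrite summxE; apply: eq_bigr => b _.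
rewrite mxE; congr (_ * _).
rewrite (_ : 'D_(delta_mx 0 b) (fun r => _) =
             fun r => 'D_(delta_mx 0 b) psi r i j).
  by have [_ ->] := derive_entry (delta_mx 0 a) i j (hpsi [:: delta_mx 0 b] y).
apply/funext => r.
by have [_ ->] := derive_entry (delta_mx 0 b) i j (hpsi [::] r).
Qed.

Lemma laplacian_psi_sym (y : 'rV[R]_l) : (laplacian_psi y)^T = laplacian_psi y.
Proof.
apply/matrixP => i j; rewrite mxE !laplacian_psi_entry.
have -> // : (fun r => psi r j i) = (fun r => psi r i j).
by apply/funext => r; rewrite -[in LHS]hpsi_sym mxE.
Qed.

Lemma invC_sym a b : invmx C a b = invmx C b a.
Proof. by case: hC => CS _ _ _; rewrite -{1}CS -trmx_inv mxE. Qed.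

(** The frame vectors along x contribute nothing since the curvature has no
x-component, those along xbar since they annihilate it. For a frame vector
along y, which has no x-component, only the first of the two terms of
[y_curvature] is left. *)
Lemma trace_curvature p x y :
  \sum_i curvature g p (coord_vec R i) x y 0 i =
  (x_coords x *m laplacian_psi (y_coords p) *m (x_coords y)^T) 0 0.
Proof.
rewrite big_split_ord big_split_ord /=.
rewrite [X in X + _ + _]big1 => [|i _]; last first.
  have /rowP/(_ i) := x_curvature p (coord_vec R (lshift k (lshift l i))) x y.
  by rewrite !mxE.
rewrite [X in _ + X]big1 => [|i _]; last first.
  by rewrite /coord_vec delta_mx_rshift -/(from_xbar _) curvature_xbar mxE.
rewrite add0r addr0 mulmx_sumr mulmx_suml summxE; apply: eq_bigr => a _.
set e := coord_vec R _.
have /rowP/(_ a) := y_curvature p e x y; rewrite mxE mxE => ->.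
rewrite [grad_hess p x _ _]grad_hess_x0 ?x_coord_vec_y // subr0.
rewrite /grad_hess summxE mulmx_sumr mulmx_suml summxE; apply: eq_bigr => b _.
rewrite y_coord_vec -scalemxAr -scalemxAl [LHS]mxE big_ord1 [RHS]mxE mulrC.
by rewrite mxE invC_sym.
Qed.

(** By symmetry of the Laplacian, the two halves of the polarized Jacobi operator
have the same trace. *)
Lemma ricci_formE p x y : ricci_form g p x y =
  (x_coords x *m laplacian_psi (y_coords p) *m (x_coords y)^T) 0 0.
Proof.
rewrite /ricci_form /mxtrace.
under eq_bigr do rewrite mxE /polarized_jacobi mxE mxE.
rewrite -mulr_sumr big_split /= !trace_curvature.
rewrite (_ : (x_coords y *m _ *m _) 0 0 =
  (x_coords x *m laplacian_psi (y_coords p) *m (x_coords y)^T) 0 0).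
  by field.
have tr00 (A : 'M[R]_1) : A 0 0 = A^T 0 0 by rewrite mxE.
by rewrite tr00 !trmx_mul trmxK laplacian_psi_sym mulmxA.
Qed.

(** The Ricci form lives on the x-directions, and [g p] matches covectors on x
with vectors along xbar ([from_xbar_g]). *)
Lemma ricci_opE p x :
  ricci_op g p x = from_xbar (x_coords x *m laplacian_psi (y_coords p)).
Proof.
apply: (can_inj (mulmxK (g_unit p))).
rewrite /ricci_op mulmxKV ?g_unit // from_xbar_g; apply/rowP => j.
rewrite mxE ricci_formE -(mul_x_frame (coord_vec R j)) trmx_mul mulmxA.
by rewrite /coord_vec trmx_delta -colE mxE.
Qed.

(** * Jacobi-Videv, nilpotency and the Einstein condition *)

Lemma from_xbar0 : from_xbar 0 = 0.
Proof. by rewrite /from_xbar row_mx0. Qed.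

Lemma ricci_op_x0 p x : x_coords x = 0 -> ricci_op g p x = 0.
Proof. by move=> x0; rewrite ricci_opE x0 mul0mx from_xbar0. Qed.

(** Both composites are zero: Jacobi operators take values without x-component,
where the Ricci operator vanishes, and they annihilate its image. *)
Lemma g_jacobi_videv : jacobi_videv g.
Proof.
move=> p x y; rewrite [RHS]ricci_op_x0 ?x_curvature //.
by rewrite ricci_opE /jacobi curvature_xbar.
Qed.

Lemma g_ricci_nilpotent : ricci_nilpotent g.
Proof. by exists 2 => p x /=; rewrite ricci_op_x0 // ricci_opE x_from_xbar. Qed.

(** The bound on [k] provides the nonzero xbar direction, annihilated by the Ricci
operator, that rules out a nonzero Einstein constant. *)
Lemma g_einstein : (1 <= k)%N ->
  einstein g <-> forall y : 'rV[R]_l, laplacian_psi y = 0.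
Proof.
move=> k_gt0; split=> [[c ric_c] y|lap0]; last first.
  by exists 0 => p x; rewrite scale0r ricci_opE lap0 mulmx0 from_xbar0.
have c0 : c = 0.
  pose i := Ordinal k_gt0.
  have := ric_c 0 (from_xbar (delta_mx 0 i)).
  rewrite ricci_op_x0 ?x_from_xbar // /from_xbar scale_row_mx.
  by move=> /rowP/(_ (rshift _ i)); rewrite row_mxEr !mxE !eqxx mulr1.
apply/row_matrixP => i; rewrite row0 rowE.
(* The base point is any point whose y-coordinates are y. *)
have := ric_c (from_y y) (coord_vec R (lshift k (lshift l i))).
rewrite c0 scale0r ricci_opE y_from_y /coord_vec !delta_mx_lshift.
by rewrite /x_coords !row_mxKl /from_xbar -[0 in RHS]row_mx0 => /eq_row_mx[].
Qed.

End CpsiMetric.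

Theorem theorem1p2 (R : realType) (k l u v : nat) (C : 'M[R]_l)
    (psi : 'rV[R]_l -> 'M[R]_k)
    (hk : (1 <= k)%N) (hl : (1 <= l)%N)
    (hC : inner_product_of_signature u v C)
    (hpsi : smooth psi) (hpsi_sym : forall y : 'rV[R]_l, (psi y)^T = psi y) :
  jacobi_videv (g_Cpsi C psi) /\
  ricci_nilpotent (g_Cpsi C psi) /\
  (einstein (g_Cpsi C psi) <->
   forall (i j : 'I_k) (y : 'rV[R]_l),
     \sum_(a < l) \sum_(b < l) invmx C a b *
       'D_(delta_mx 0 a) ('D_(delta_mx 0 b) (fun z : 'rV[R]_l => psi z i j)) y
     = 0).
Proof.
split; first exact: g_jacobi_videv hC hpsi hpsi_sym.
split; first exact: g_ricci_nilpotent hC hpsi hpsi_sym.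
have lapE := laplacian_psi_entry R k l C psi hpsi.
have einsteinE := g_einstein R k l u v C psi hC hpsi hpsi_sym hk.
split=> [/einsteinE lap0 i j y|lap0].
  by rewrite -lapE lap0 mxE.
apply/einsteinE => y.
by apply/matrixP => i j; rewrite lapE lap0 mxE.
Qed.
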